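(* Let $(X,G)$ be a CR-dynamical system. Then the following hold. (1) $(X,G)$ is $1$-backward minimal if and only if $(X,G)$ is $1^{\ominus}$-minimal. (2) If $(X,G)$ is $1^{\ominus}$-minimal, then $(X,G)$ is $2^{\ominus}$-minimal. (3) If $(X,G)$ is $2^{\ominus}$-minimal, then $(X,G)$ is $3^{\ominus}$-minimal. (4) If $(X,G)$ is $3^{\ominus}$-minimal, then $(X,G)$ is $\infty$-backward minimal.
   Context: A CR-dynamical system is a pair $(X,G)$ where $X$ is a compact metric space and $G\subseteq X\times X$ is a non-empty closed subset. Let $p_2(x,y)=y$ be the second projection $X\times X\to X$, and $G^{-1}=\{(y,x):(x,y)\in G\}$. Backward invariance: $A\subseteq X$ is $1$-backward invariant in $(X,G)$ if for each $y\in A$ with $y\in p_2(G)$ there is $x\in A$ such that $(x,y)\in G$; $A$ is $\infty$-backward invariant in $(X,G)$ if for each $(x,y)\in G$, $y\in A$ implies $x\in A$. For $k\in\{1,\infty\}$, $(X,G)$ is $k$-backward minimal if every closed subset $A$ of $X$ that is $k$-backward invariant in $(X,G)$ satisfies $A\in\{\emptyset,X\}$. Backward orbits: $\star_{i=1}^{\infty}G^{-1}=\{(x_1,x_2,x_3,\ldots)\in\prod_{i=1}^\infty X : (x_i,x_{i+1})\in G^{-1} \text{ for each positive integer } i\}$, and $\pi_k$ denotes the $k$-th coordinate projection. For $x\in X$, $T_G^{-}(x)=\{\mathbf x\in\star_{i=1}^{\infty}G^{-1} : \pi_1(\mathbf x)=x\}$. For $\mathbf x\in\star_{i=1}^{\infty}G^{-1}$,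 $\mathcal O_G^{\ominus}(\mathbf x)=\{\pi_k(\mathbf x): k\ge 1\}\subseteq X$. For $x\in X$, $\mathcal U_G^{\ominus}(x)=\bigcup_{\mathbf x\in T_G^{-}(x)}\mathcal O_G^{\ominus}(\mathbf x)$. $\mathrm{Cl}$ denotes closure in $X$. $(X,G)$ is $1^{\ominus}$-minimal if $T_G^{-}(x)\ne\emptyset$ for each $x\in X$ and $\mathrm{Cl}(\mathcal O_G^{\ominus}(\mathbf x))=X$ for each $\mathbf x\in\star_{i=1}^{\infty}G^{-1}$; it is $2^{\ominus}$-minimal if for each $x\in X$ there is $\mathbf x\in T_G^{-}(x)$ with $\mathrm{Cl}(\mathcal O_G^{\ominus}(\mathbf x))=X$; it is $3^{\ominus}$-minimal if $\mathrm{Cl}(\mathcal U_G^{\ominus}(x))=X$ for each $x\in X$. *)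

(* Defs.v *)
From mathcomp Require Import all_boot all_order all_algebra.
From mathcomp Require Import all_classical all_reals all_analysis.

Set Implicit Arguments.
Unset Strict Implicit.
Unset Printing Implicit Defensive.

Local Open Scope classical_set_scope.

(* Sequences are indexed from 0, so the projection pi_k is evaluation at k - 1. *)

Definition cr_dynamical_system (R : realType) (X : metricType R)
    (G : set (X * X)) : Prop :=
  [/\ compact [set: X], G !=set0 & closed G].

Definition backward_invariant1 (X : Type) (G : set (X * X)) (A : set X) : Prop :=
  forall y, A y -> (snd @` G) y -> exists2 x, A x & G (x, y).

Definition backward_invariant_oo (X : Type) (G : set (X * X)) (A : set X) : Prop :=
  forall x y, G (x, y) -> A y -> A x.

Definition backward_minimal1 (X : topologicalType) (G : set (X * X)) : Prop :=
  forall A : set X, closed A -> backward_invariant1 G A ->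
    A = set0 \/ A = [set: X].

Definition backward_minimal_oo (X : topologicalType) (G : set (X * X)) : Prop :=
  forall A : set X, closed A -> backward_invariant_oo G A ->
    A = set0 \/ A = [set: X].

(* The infinite Mahavier product of G^-1. *)
Definition mahavier_inv (X : Type) (G : set (X * X)) : set (nat -> X) :=
  [set s | forall i, (G^-1)%relation (s i, s i.+1)].

Definition backward_trajectories (X : Type) (G : set (X * X)) (x : X) :
    set (nat -> X) :=
  [set s | mahavier_inv G s /\ s 0 = x].

Definition backward_orbit (X : Type) (s : nat -> X) : set X := range s.

Definition backward_orbits_union (X : Type) (G : set (X * X)) (x : X) : set X :=
  \bigcup_(s in backward_trajectories G x) backward_orbit s.

Definition ominus_minimal1 (X : topologicalType) (G : set (X * X)) : Prop :=
  (forall x, backward_trajectories G x !=set0) /\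
  (forall s, mahavier_inv G s -> closure (backward_orbit s) = [set: X]).

Definition ominus_minimal2 (X : topologicalType) (G : set (X * X)) : Prop :=
  forall x, exists2 s, backward_trajectories G x s &
    closure (backward_orbit s) = [set: X].

Definition ominus_minimal3 (X : topologicalType) (G : set (X * X)) : Prop :=
  forall x, closure (backward_orbits_union G x) = [set: X].

(* Main.v *)
Require Import Defs.
From mathcomp Require Import all_boot all_order all_algebra.
From mathcomp Require Import all_classical all_reals all_analysis.

(** The closure A of a backward orbit is 1-backward invariant: the image under
    the second projection of the compact set of edges starting in A is closed,
    and it contains the orbit, hence also A. Conversely, once every point has a
    predecessor, a nonempty closed 1-backward invariant set contains a whole
    backward trajectory, hence also the closure of its orbit. *)

Local Open Scope classical_set_scope.

(** Dependent choice is run on the subtype of points of [A], so that the chosen predecessors never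
    leave [A]. *)
Lemma backward_trajectory_in {X : Type} {G : set (X * X)} {A : set X} {x : X} :
  (forall y, (snd @` G) y) -> backward_invariant1 G A -> A x ->
  exists2 s, backward_trajectories G x s & range s `<=` A.
Proof.
move=> sG invA Ax.
have step (u : {y | A y}) : {v : {y | A y} | G (sval v, sval u)}.
  case: u => y Ay; apply/cid.
  by have [z Az Gzy] := invA y Ay (sG y); exists (exist _ z Az).
have [s [s0 sS]] := dependent_choice step (exist _ x Ax).
exists (fun n => sval (s n)); first by split=> [n|]; [exact: sS | rewrite s0].
by move=> _ [n _ <-]; exact: svalP.
Qed.

Lemma backward_orbits_union_sub {X : Type} {G : set (X * X)} {A : set X}
    {x : X} :
  backward_invariant_oo G A -> A x -> backward_orbits_union G x `<=` A.
Proof.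
move=> invA Ax _ [s [sG s0] [n _ <-]].
by elim: n => [|n IHn]; [rewrite s0 | exact: invA (sG n) IHn].
Qed.

Lemma closed_dense_subset {X : topologicalType} {A B : set X} :
  closed A -> B `<=` A -> closure B = [set: X] -> A = [set: X].
Proof.
move=> clA BA clB; apply/seteqP; split=> // x _.
by rewrite (closure_id A).1 //; apply: (closureS BA); rewrite clB.
Qed.

(** The edges starting in [A] form a closed subset of the compact square, so their continuous image
    is compact, hence closed in a Hausdorff space. *)
Lemma closed_successors {X : topologicalType} {G : set (X * X)} {A : set X} :
  hausdorff_space X -> compact [set: X] -> closed G -> closed A ->
  closed (snd @` (G `&` (fst @^-1` A))).
Proof.
move=> hX cX clG clA; apply: (compact_closed hX).
apply: continuous_compact.
  by apply: continuous_subspaceT => p; exact: cvg_snd.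
apply: (@subclosed_compact _ _ [set: X * X]) => //.
- apply: closedI clG _; apply: closed_comp clA.
  by move=> p _; exact: cvg_fst.
- by rewrite -setXTT; exact: compact_setX.
Qed.

Lemma closure_orbit_invariant1 {X : topologicalType} {G : set (X * X)}
    {s : nat -> X} :
  hausdorff_space X -> compact [set: X] -> closed G -> mahavier_inv G s ->
  backward_invariant1 G (closure (range s)).
Proof.
move=> hX cX clG sG y cly _.
have clS := closed_successors hX cX clG (@closed_closure _ (range s)).
(* Each orbit point [s n] is the endpoint of the edge from the next orbit point [s n.+1]. *)
have orbitS : range s `<=` snd @` (G `&` (fst @^-1` closure (range s))).
  move=> _ [n _ <-]; exists (s n.+1, s n) => //; split; first exact: sG.
  by apply: subset_closure; exists n.+1.
have := closureS orbitS cly; rewrite -(closure_id _).1 //.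
by move=> [[x z] [Gxz Ax] /= <-]; exists x.
Qed.

(* A point y outside p_2(G) would make {y} vacuously 1-backward invariant. *)
Lemma backward_minimal1_surjective {X : topologicalType} {G : set (X * X)} :
  hausdorff_space X -> G !=set0 -> backward_minimal1 G ->
  forall y, (snd @` G) y.
Proof.
move=> hX [[a b] Gab] minG y; apply: contrapT => yG.
have [] := minG [set y].
- exact/accessible_closed_set1/hausdorff_accessible.
- by move=> _ -> /yG.
- by move=> /seteqP[/(_ y erefl)].
- by move=> /seteqP[_ /(_ b I) by_]; apply: yG; exists (a, b).
Qed.

Theorem theorem7p8 (R : realType) (X : metricType R) (G : set (X * X))
    (hG : cr_dynamical_system G) :
  [/\ backward_minimal1 G <-> ominus_minimal1 G,
      ominus_minimal1 G -> ominus_minimal2 G,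
      ominus_minimal2 G -> ominus_minimal3 G
    & ominus_minimal3 G -> backward_minimal_oo G].
Proof.
have [cX G0 clG] := hG; have hX := @metric_hausdorff R X.
split.
- split=> [minG | [T0 dense] A clA invA].
    have sG := backward_minimal1_surjective hX G0 minG.
    split=> [x | s sG'].
      (* Trajectories from an arbitrary [x] come from taking the whole space as the invariant
         set. *)
      have invT : backward_invariant1 G [set: X].
        by move=> y _ [[z w] Gzw /= <-]; exists z.
      by have [s Ts _] := backward_trajectory_in sG invT (I : [set: X] x); exists s.
    have [] // := minG (closure (range s)).
    + exact: closed_closure.
    + exact: closure_orbit_invariant1.
    + move=> /seteqP[/(_ (s 0)) s0 _]; case: s0.
      by apply: subset_closure; exists 0.
  have [->|/set0P[x Ax]] := eqVneq A set0; [by left | right].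
  (* The first step of a trajectory from [y] is an edge of [G] ending at [y]. *)
  have sG y : (snd @` G) y.
    by have [s [sG s0]] := T0 y; exists (s 1, s 0); [exact: sG |].
  have [s [sG' _] sA] := backward_trajectory_in sG invA Ax.
  exact: closed_dense_subset clA sA (dense s sG').
- by move=> [T0 dense] x; have [s Ts] := T0 x; exists s => //; apply: dense; case: Ts.
- move=> min2 x; have [s Ts sX] := min2 x.
  (* The dense orbit of [s] is one of the orbits in the union. *)
  apply: (closed_dense_subset (@closed_closure _ _) _ sX) => y sy.
  by apply: subset_closure; exists s.
- move=> min3 A clA invA.
  have [->|/set0P[x Ax]] := eqVneq A set0; [by left | right].
  exact: closed_dense_subset clA (backward_orbits_union_sub invA Ax) (min3 x).
Qed.
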